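(* Let $r,n\in\mathbb{Z}_{\geq 0}$, and consider face-firing with marked face $f_0$ of weight $n$ on the square grid, starting from the pulse $K(n,r)$. 1. If $r\leq 1$, then firing from $K(n,r)$ terminates uniquely in the Aztec diamond $\mathrm{Az}(n)$. 2. If $2\leq r\leq \lceil n/2\rceil$, then firing from $K(n,r)$ does not terminate uniquely, but can terminate in $\mathrm{Az}(n)$. 3. If $r>\lceil n/2\rceil$, then firing from $K(n,r)$ does not terminate uniquely. Moreover, if $r\geq \lceil n/\sqrt{3}\rceil+1$, then firing from $K(n,r)$ will never terminate in $\mathrm{Az}(n)$.
   Context: The grid complex is the tiling of the plane by unit squares (''faces''), indexed by $\mathbb{Z}^2$; two faces are adjacent if they share an edge, and $\mathrm{dist}(f,g)$ is the Manhattan distance between faces. A configuration $K$ assigns an integer weight $K_f$ to each face $f$, with finitely many nonzero weights. Fix a marked face $f_0$ and an integer $n$ with $K_{f_0}=n$. Firing moves: (i) if $f,g$ are adjacent faces, both different from $f_0$, with $K_f\geq K_g+2$, one may fire $f$ towards $g$, decreasing $K_f$ by $1$ and increasing $K_g$ by $1$; (ii) if $g$ is adjacent to $f_0$ and $K_g<n$, one may fire from $f_0$ to $g$, increasing $K_g$ by $1$ (the weight of $f_0$ stays $n$); (iii) if $g$ is adjacent to $f_0$ and $K_g>n$, one may fire from $g$ to $f_0$, decreasing $K_g$ by $1$ (the weight of $f_0$ stays $n$). No other moves are allowed. A configuration is stable if no firing move is possible. Firing from $K$ terminates uniquely in $C$ if every sequence of firing moves from $K$ is finite and every maximal such sequence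 ends at the stable configuration $C$; firing from $K$ terminates uniquely if this holds for some $C$; firing from $K$ can terminate in $C$ if some finite sequence of firing moves from $K$ reaches the stable configuration $C$. The pulse $K(n,r)$ has $K(n,r)_f=n$ if $\mathrm{dist}(f_0,f)\leq r$ and $0$ otherwise. The Aztec diamond $\mathrm{Az}(n)$ has $\mathrm{Az}(n)_{f_0}=n$ and $\mathrm{Az}(n)_f=\max\{n-\mathrm{dist}(f_0,f)+1,0\}$ for $f\neq f_0$.
   Formalization: In item 3, ''does not terminate uniquely'' is stated for n ≥ 2 and ''will never terminate in Az(n)'' for n ≥ 1, since for n = 0 or 1 with r > ⌈n/2⌉ the pulse is already stable (and for n = 0 equals Az(0)), so these claims fail there. *)

(* Defs.v *)
From Stdlib Require Import Relation_Operators.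
From mathcomp Require Import all_boot all_order all_algebra.
From mathcomp Require Import finmap.
From mathcomp Require Import zify.

Set Implicit Arguments.
Unset Strict Implicit.
Unset Printing Implicit Defensive.

Import Order.TTheory GRing.Theory Num.Theory.

Local Open Scope ring_scope.

(* The face (a, b) is the unit square [a, a + 1] x [b, b + 1]. *)
Definition face : Type := (int * int)%type.

Definition dist (f g : face) : nat := (`|f.1 - g.1| + `|f.2 - g.2|)%N.

Definition adjacent (f g : face) : bool :=
  ((f.1 == g.1) && (`|f.2 - g.2|%N == 1%N))
  || ((f.2 == g.2) && (`|f.1 - g.1|%N == 1%N)).

Lemma adjacentE (f g : face) : adjacent f g = (dist f g == 1%N).
Proof. case: f g => [a b] [c d]; rewrite /adjacent /dist /=; lia. Qed.

Definition config : Type := {fsfun face -> int with 0}.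

(* A single firing move.  The constant weight n of the marked face f0 is
   read off the configuration, as K f0; see firing_marked. *)
Inductive firing (f0 : face) (K : config) : config -> Prop :=
| fire_between (f g : face) of
    adjacent f g & f != f0 & g != f0 & K g + 2 <= K f :
    firing f0 K [fsfun K with f |-> K f - 1, g |-> K g + 1]
| fire_from_marked (g : face) of adjacent f0 g & K g < K f0 :
    firing f0 K [fsfun K with g |-> K g + 1]
| fire_to_marked (g : face) of adjacent f0 g & K f0 < K g :
    firing f0 K [fsfun K with g |-> K g - 1].

Lemma firing_marked (f0 : face) (K K' : config) :
  firing f0 K K' -> K' f0 = K f0.
Proof.
case=> [f g _ fN0 gN0 _ | g adj0g _ | g adj0g _]; rewrite !fsfun_withE.
- by rewrite eq_sym (negPf fN0) eq_sym (negPf gN0).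
- by case: eqP adj0g => // <-; rewrite adjacentE /dist !subrr.
- by case: eqP adj0g => // <-; rewrite adjacentE /dist !subrr.
Qed.

Definition fires (f0 : face) : config -> config -> Prop :=
  clos_refl_trans_1n config (firing f0).

Definition stable (f0 : face) (K : config) : Prop :=
  forall K' : config, ~ firing f0 K K'.

Definition infinite_firing (f0 : face) (K : config) (s : nat -> config) : Prop :=
  s 0%N = K /\ forall i : nat, firing f0 (s i) (s i.+1).

(* A finite firing sequence is maximal iff its last configuration is stable. *)
Definition terminates_uniquely_in (f0 : face) (K C : config) : Prop :=
  [/\ ~ (exists s : nat -> config, infinite_firing f0 K s),
      stable f0 C
    & forall K' : config, fires f0 K K' -> stable f0 K' -> K' = C].

Definition terminates_uniquely (f0 : face) (K : config) : Prop :=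
  exists C : config, terminates_uniquely_in f0 K C.

Definition can_terminate_in (f0 : face) (K C : config) : Prop :=
  fires f0 K C /\ stable f0 C.

Definition box (f0 : face) (r : nat) : seq face :=
  [seq (f0.1 + i%:Z - r%:Z, f0.2 + j%:Z - r%:Z)
  | i <- iota 0 (2 * r).+1, j <- iota 0 (2 * r).+1].

Definition ball (f0 : face) (r : nat) : {fset face} :=
  [fset f in box f0 r | (dist f0 f <= r)%N]%fset.

Lemma in_box (f0 f : face) (r : nat) : (dist f0 f <= r)%N -> f \in box f0 r.
Proof.
move=> le_f; apply/allpairsP.
exists (absz (f.1 - f0.1 + r%:Z), absz (f.2 - f0.2 + r%:Z)); rewrite !mem_iota.
case: f0 f le_f => [a b] [c d]; rewrite /dist /fst /snd => le_cd.
by split; [lia | lia | congr pair; lia].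
Qed.

Lemma in_ball (f0 f : face) (r : nat) : (f \in ball f0 r) = (dist f0 f <= r)%N.
Proof. by rewrite in_fset inE andb_idl //; apply: in_box. Qed.

Definition pulse (f0 : face) (n r : nat) : config :=
  [fsfun f in ball f0 r => n%:Z].

Lemma pulseE (f0 : face) (n r : nat) (f : face) :
  pulse f0 n r f = if (dist f0 f <= r)%N then n%:Z else 0.
Proof. by rewrite fsfunE in_ball. Qed.

Definition aztec (f0 : face) (n : nat) : config :=
  [fsfun f in ball f0 n =>
     if f == f0 then n%:Z else Num.max (n%:Z - (dist f0 f)%:Z + 1) 0].

Lemma aztecE (f0 : face) (n : nat) (f : face) :
  aztec f0 n f =
  if f == f0 then n%:Z else Num.max (n%:Z - (dist f0 f)%:Z + 1) 0.
Proof.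
rewrite fsfunE in_ball; case: leqP => // lt_nf.
case: eqP lt_nf => [->|_]; rewrite /dist ?subrr //; lia.
Qed.

(* Degenerate weights n = 0 and n = 1: with r as below, the pulse is already
   stable, so firing does terminate uniquely; for n = 0 it is also aztec f0 0. *)
Lemma stable_terminates (f0 : face) (K : config) :
  stable f0 K -> terminates_uniquely_in f0 K K.
Proof.
move=> stK; split=> // [[s [s0 step_s]]|K'].
  by move: (step_s 0%N); rewrite s0; apply: stK.
by case=> // K1 K2 /stK.
Qed.

Lemma pulse_stable_small (f0 : face) (n r : nat) :
  (n <= 1)%N -> (n <= r)%N -> stable f0 (pulse f0 n r).
Proof.
move=> le_n1 le_nr K'; case=> [f g _ _ _ | g | g]; rewrite !pulseE.
- by do 2!case: ifP => _; lia.
- by rewrite adjacentE => /eqP ->; rewrite /dist !subrr /=; case: leqP; lia.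
- by rewrite adjacentE => /eqP ->; rewrite /dist !subrr /=; case: leqP; lia.
Qed.

Lemma pulse_small (f0 : face) (n r : nat) :
  (n <= 1)%N -> (n <= r)%N -> terminates_uniquely f0 (pulse f0 n r).
Proof.
move=> le_n1 le_nr; exists (pulse f0 n r).
exact/stable_terminates/pulse_stable_small.
Qed.

Lemma pulse0_aztec (f0 : face) (r : nat) :
  can_terminate_in f0 (pulse f0 0 r) (aztec f0 0).
Proof.
have <- : pulse f0 0 r = aztec f0 0.
  apply/fsfunP => f; rewrite pulseE aztecE if_same.
  case: eqP => [//|/eqP]; case: f0 f => [a b] [c d].
  by rewrite xpair_eqE /dist /fst /snd; lia.
by split; [apply: rt1n_refl | apply: pulse_stable_small].
Qed.

(* Main.v *)
(* No weight ever leaves [0, n], so the marked face only emits chips and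
   the sum of (n - K_f)^2 decreases: firing terminates. An upper bound that is
   1-Lipschitz away from f0 and at least n next to f0 survives firing, and a
   stable configuration dominates Az(n); hence a configuration below Az(n) can
   only end in Az(n), which settles r <= 1.

   For r <= n/2 (rounded up), cut the plane minus f0 into rays and fire outwards
   along each ray only. A stable ray is a staircase with at most one repeated
   step, and its number of chips keeps it below Az(n). On the other hand,
   freezing a face at distance 2 while all others stabilise produces more chips
   than Az(n) has, and chips never disappear: two different ends.

   For r > n/2 (rounded up), some face g can be filled by spreading chips along
   one row, and a filled face is never empty again; spreading the nearby chips
   differently brings every weight below dist(., g), which keeps g empty forever.
   Finally, for r >= n/sqrt 3 + 1 the pulse has more chips than Az(n). *)

Require Import Defs.
From Stdlib Require Import Relation_Operators Classical.
From mathcomp Require Import all_boot all_order all_algebra all_field.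
From mathcomp Require Import finmap zify ring.

Set Implicit Arguments.
Unset Strict Implicit.
Unset Printing Implicit Defensive.

Import Order.TTheory GRing.Theory Num.Theory.

Local Open Scope ring_scope.

(** * Moves, runs and restricted runs *)

Definition move (K : config) (f g : face) : config :=
  [fsfun K with f |-> K f - 1, g |-> K g + 1].

Lemma adjacent_neq (f g : face) : adjacent f g -> f != g.
Proof. by rewrite adjacentE; apply: contraTneq => ->; rewrite /dist !subrr. Qed.

Lemma adjacentC (f g : face) : adjacent f g = adjacent g f.
Proof. rewrite !adjacentE /dist; lia. Qed.

Lemma dist_adjacent (e f g : face) : adjacent f g -> (dist e f <= (dist e g).+1)%N.
Proof. rewrite adjacentE /dist; lia. Qed.

Lemma moveE (K : config) (f g h : face) : f != g ->
  move K f g h = K h - (h == f)%:Z + (h == g)%:Z.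
Proof.
move=> fg; rewrite /move !fsfun_withE.
have [->|hf] := eqVneq h f; first by rewrite (negPf fg) addr0.
by have [->|hg] := eqVneq h g; rewrite /= subr0 ?addr0.
Qed.

Lemma fires_trans (f0 : face) (K1 K2 K3 : config) :
  fires f0 K1 K2 -> fires f0 K2 K3 -> fires f0 K1 K3.
Proof.
by elim=> // A B C AB _ IH /IH; apply: rt1n_trans.
Qed.

Lemma fires1 (f0 : face) (K K' : config) : firing f0 K K' -> fires f0 K K'.
Proof. by move=> s; apply: rt1n_trans s _; apply: rt1n_refl. Qed.

Lemma fires_inv (f0 : face) (P : config -> Prop) (K K' : config) :
  (forall A B, P A -> firing f0 A B -> P B) -> fires f0 K K' -> P K -> P K'.
Proof. by move=> PS; elim=> // A B C AB _ IH /PS/(_ AB)/IH. Qed.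

(** Stated as well-foundedness, which supports induction along firing runs. *)
Definition terminating (f0 : face) : config -> Prop :=
  Acc (fun K' K => firing f0 K K').

Lemma terminating_no_infinite (f0 : face) (K : config) :
  terminating f0 K -> ~ exists s : nat -> config, infinite_firing f0 K s.
Proof.
elim=> {}K _ IH [s [s0 sS]].
apply: (IH (s 1%N)); first by rewrite -s0; apply: sS.
by exists (fun i => s i.+1); split.
Qed.

(** The device behind all special runs below (frozen corner, rays, windows): fire only moves of [R]
    until none is left, carrying an invariant that may depend on [R]. *)
Lemma restricted_stabilization (f0 : face) (R : config -> config -> Prop)
    (P : config -> Prop) (K : config) :
  (forall A B, R A B -> firing f0 A B) ->
  (forall A B, P A -> R A B -> P B) ->
  terminating f0 K -> P K ->
  exists K', [/\ fires f0 K K', P K' & forall K'', ~ R K' K''].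
Proof.
move=> Rf RP; elim=> {}K _ IH PK.
have [[K1 R1]|noR] := classic (exists K1, R K K1); last first.
  exists K; split=> //; first exact: rt1n_refl.
  by move=> K1 R1; apply: noR; exists K1.
have [K' [s PK' stK']] := IH K1 (Rf _ _ R1) (RP _ _ PK R1).
by exists K'; split=> //; apply: rt1n_trans s; apply: Rf.
Qed.

Lemma stabilization (f0 : face) (K : config) :
  terminating f0 K -> exists2 K', fires f0 K K' & stable f0 K'.
Proof.
move=> /(@restricted_stabilization f0 (firing f0) (fun => True)).
by case=> // K' [? _ ?]; exists K'.
Qed.

(** * Invariants and termination *)

(* The last clause bounds the support: it holds of the pulse with
   B = n + r + 1, and survives firing because dist f0 is 1-Lipschitz. *)
Definition tame (f0 : face) (n B : nat) (K : config) : Prop :=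
  K f0 = n%:Z /\
  forall f, 0 <= K f <= n%:Z /\ (0 < K f -> K f + (dist f0 f)%:Z <= B%:Z).

(** Firing into [f0] is absent because it requires a weight above [n]. *)
Inductive tame_firing (f0 : face) (n : nat) (K : config) : config -> Prop :=
| tame_move (f g : face) of
    adjacent f g & f != f0 & g != f0 & K g + 2 <= K f :
    tame_firing f0 n K (move K f g)
| tame_source (g : face) of adjacent f0 g & K g < n%:Z :
    tame_firing f0 n K [fsfun K with g |-> K g + 1].

Lemma tame_firingP (f0 : face) (n B : nat) (K K' : config) :
  tame f0 n B K -> firing f0 K K' -> tame_firing f0 n K K'.
Proof.
move=> [K0 tK]; case=> [f g fg f0' g0' Kfg|g fg Kg|g fg Kg].
- exact: tame_move.
- by apply: tame_source; rewrite -?K0.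
- by have [] := tK g; lia.
Qed.

(** After a move, [g] weighs at most one less than [f] did and is at most one step farther from
    [f0]. A chip from [f0] lands at distance 1, where [n < B] gives the support bound. *)
Lemma tameS (f0 : face) (n B : nat) (K K' : config) :
  (n < B)%N -> tame f0 n B K -> firing f0 K K' -> tame f0 n B K'.
Proof.
move=> nB tK s; split; first by rewrite (firing_marked s) (proj1 tK).
have [K0 {}tK] := (tK, proj2 tK).
case: (tame_firingP K0 s) => [f g fg f0' g0' Kfg|g fg Kg] h.
- rewrite moveE ?adjacent_neq //.
  have := tK h; have := tK f; have := tK g.
  have := dist_adjacent f0 fg; have := dist_adjacent f0 (etrans (adjacentC g f) fg).
  have [->|hf] := eqVneq h f; first by rewrite (negPf (adjacent_neq fg)); lia.
  by have [->|hg] := eqVneq h g; rewrite /= ?subr0 ?addr0 //; lia.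
- rewrite fsfun_withE; have := tK h; have := tK g; move: fg; rewrite adjacentE.
  by case: (h =P g) => [->|]; lia.
Qed.

Lemma tame_fires (f0 : face) (n B : nat) (K K' : config) :
  (n < B)%N -> fires f0 K K' -> tame f0 n B K -> tame f0 n B K'.
Proof. by move=> nB; apply: fires_inv => A C; apply: tameS. Qed.

Lemma uniq_box (f0 : face) (B : nat) : uniq (box f0 B).
Proof.
apply: allpairs_uniq; rewrite ?iota_uniq // => -[i j] [i' j'] _ _ /= [].
by move=> h1 h2; congr pair; lia.
Qed.

Lemma sum_move (s : seq face) (K : config) (f g : face) : uniq s -> f != g ->
  \sum_(h <- s) move K f g h =
  \sum_(h <- s) K h - (f \in s)%:Z + (g \in s)%:Z.
Proof.
move=> us fg; rewrite (eq_bigr _ (fun h _ => moveE K h fg)).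
have cnt x : \sum_(h <- s) (h == x)%:Z = (x \in s)%:Z.
  rewrite -(count_uniq_mem _ us); elim: (s) => [|h t IH]; first by rewrite big_nil.
  by rewrite big_cons IH /= PoszD.
by rewrite big_split sumrB /= !cnt.
Qed.

(** For a tame configuration the box contains the whole support, so this is the total number of
    chips. *)
Definition chips (f0 : face) (B : nat) (K : config) : int :=
  \sum_(f <- box f0 B) K f.

Lemma chips_firing (f0 : face) (n B : nat) (K K' : config) :
  tame f0 n B K -> firing f0 K K' -> chips f0 B K <= chips f0 B K'.
Proof.
move=> tK /(tame_firingP tK) [f g fg f0' g0' Kfg|g fg Kg]; rewrite /chips.
  have [_ bK] := tK; have := bK f; have := bK g => bg bf.
  rewrite sum_move ?uniq_box ?adjacent_neq // !in_box //; try lia.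
  by have := dist_adjacent f0 (etrans (adjacentC g f) fg); lia.
apply: ler_sum => h _; rewrite fsfun_withE; case: (h =P g) => [->|]; lia.
Qed.

Lemma chips_fires (f0 : face) (n B : nat) (K K' : config) : (n < B)%N ->
  fires f0 K K' -> tame f0 n B K -> chips f0 B K <= chips f0 B K'.
Proof.
move=> nB; elim=> // A C D AC _ IH tA.
exact: le_trans (chips_firing tA AC) (IH (tameS nB tA AC)).
Qed.

Lemma sqr_spread (x y : int) : x + 2 <= y ->
  (x + 1) ^+ 2 + (y - 1) ^+ 2 < x ^+ 2 + y ^+ 2.
Proof.
move=> xy; rewrite -subr_gt0.
have -> : x ^+ 2 + y ^+ 2 - ((x + 1) ^+ 2 + (y - 1) ^+ 2) = 2 * (y - x - 1) by ring.
lia.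
Qed.

Lemma tame_terminating (f0 : face) (n B : nat) (K : config) :
  (n < B)%N -> tame f0 n B K -> terminating f0 K.
Proof.
move=> nB tK; have [b ub inb] : exists2 b, uniq b & forall f, (dist f0 f <= B)%N -> f \in b.
  by exists (box f0 B); [apply: uniq_box | move=> f; apply: in_box].
pose phi (K : config) : int := \sum_(f <- b) (n%:Z - K f) ^+ 2.
have [m] : exists m, (absz (phi K) < m)%N by exists (absz (phi K)).+1.
elim: m K tK => [K _|m IH K tK le_m]; first by rewrite ltn0.
constructor=> K' s; apply: IH (tameS nB tK s) _.
suff lt : phi K' < phi K.
  have: 0 <= phi K' by apply: sumr_ge0 => h _; apply: sqr_ge0.
  by lia.
have [_ bK] := tK; case: (tame_firingP tK s) => [f g fg f0' g0' Kfg|g fg Kg].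
  have ds := dist_adjacent f0 (etrans (adjacentC g f) fg).
  have fB : f \in b by apply: inb; have := bK f; have := bK g; lia.
  have gB : g \in b by apply: inb; have := bK f; have := bK g; lia.
  have nfg := adjacent_neq fg.
  rewrite /phi !(bigD1_seq f fB ub) /=.
  rewrite -!(big_filter _ (fun i => i != f)).
  have gB' : g \in [seq i <- b | i != f] by rewrite mem_filter eq_sym nfg.
  rewrite !(bigD1_seq g gB') ?filter_uniq  //=.
  rewrite !moveE // !eqxx (negPf nfg) eq_sym (negPf nfg) /=.
  rewrite !addrA; apply: ltr_leD.
    rewrite !(subr0, addr0) (_ : n%:Z - (K f - 1) = n%:Z - K f + 1); last by ring.
    rewrite (_ : n%:Z - (K g + 1) = n%:Z - K g - 1); last by ring.
    by apply: sqr_spread; lia.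
  rewrite le_eqVlt; apply/orP; left; apply/eqP.
  rewrite -!(big_filter _ (fun i => i != g)); apply: eq_big_seq => i.
  rewrite !mem_filter => /and3P[/negPf iNg /negPf iNf _].
  by rewrite moveE // iNf iNg subr0 addr0.
have gB : g \in b by apply: inb; move: fg; rewrite adjacentE; lia.
rewrite /phi !(bigD1_seq g gB ub) /= fsfun_withE eqxx.
apply: ltr_leD.
  rewrite -subr_gt0 (_ : _ - _ = 2 * (n%:Z - K g) - 1); last by ring.
  lia.
by apply: ler_sum => i /negPf iNg; rewrite fsfun_withE iNg.
Qed.

(** * Upper and lower bounds *)

Definition lipschitz_off (f0 : face) (U : face -> int) : Prop :=
  forall f g, adjacent f g -> f != f0 -> g != f0 -> U f <= U g + 1.

(** A move leaves [g] with at most [K f - 1 <= U f - 1 <= U g], and a chip from [f0] raises [g] to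
    at most [n <= U g]. *)
Lemma upper_fires (f0 : face) (n B : nat) (U : face -> int) (K K' : config) :
  (n < B)%N -> lipschitz_off f0 U ->
  (forall g, adjacent f0 g -> n%:Z <= U g) ->
  tame f0 n B K -> fires f0 K K' ->
  (forall f, f != f0 -> K f <= U f) -> forall f, f != f0 -> K' f <= U f.
Proof.
move=> nB UL Un tK KK' KU.
suff [] : tame f0 n B K' /\ forall f, f != f0 -> K' f <= U f by [].
pose P (L : config) := tame f0 n B L /\ forall f, f != f0 -> L f <= U f.
apply: (@fires_inv _ P _ _ _ KK') => // {KK'} A C [tA AU] s.
split=> [|h hf0]; first exact: tameS s.
case: (tame_firingP tA s) => [f g fg f0' g0' Kfg|g fg Kg].
  have nfg := adjacent_neq fg; rewrite moveE //.
  have := AU h hf0; have := AU f f0'; have := UL f g fg f0' g0'.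
  have [->|hf] := eqVneq h f; first by rewrite (negPf nfg); lia.
  by have [->|hg] := eqVneq h g; rewrite /= ?subr0 ?addr0 //; lia.
rewrite fsfun_withE; have := AU h hf0; have := Un g fg.
by case: (h =P g) => [->|]; lia.
Qed.

(** A face that gives away a chip has weight at least 2, since its neighbour has weight at least
    0. *)
Lemma support_fires (f0 : face) (n B : nat) (K K' : config) (g : face) :
  (n < B)%N -> tame f0 n B K -> fires f0 K K' -> 1 <= K g -> 1 <= K' g.
Proof.
move=> nB tK KK' Kg.
suff [] : tame f0 n B K' /\ 1 <= K' g by [].
pose P (L : config) := tame f0 n B L /\ 1 <= L g.
apply: (@fires_inv _ P _ _ _ KK') => // {KK' Kg} A C [tA Ag] s.
split; first exact: tameS s.
case: (tame_firingP tA s) => [h k hk _ _ Kfg|k fk Kk].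
  have nhk := adjacent_neq hk; rewrite moveE //.
  have [_ /(_ k)] := tA.
  have [gh|gh] := eqVneq g h; first by rewrite gh (negPf nhk); lia.
  by have [gk|gk] := eqVneq g k; rewrite /= ?subr0 ?addr0 //; lia.
by rewrite fsfun_withE; case: (g =P k) => [gk|]; rewrite -?gk; lia.
Qed.

(* Confluence fails because a face that one run can fill is walled off forever
   by another run. *)
Lemma not_unique_by_support (f0 : face) (n B : nat) (K K1 K2 : config) (g : face) :
  (n < B)%N -> tame f0 n B K -> (n < dist f0 g)%N ->
  fires f0 K K1 -> 1 <= K1 g ->
  fires f0 K K2 -> (forall f, f != f0 -> K2 f <= (dist f g)%:Z) ->
  ~ terminates_uniquely f0 K.
Proof.
move=> nB tK ng KK1 K1g KK2 K2U [C [_ _ CP]].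
have t1 := tame_fires nB KK1 tK; have t2 := tame_fires nB KK2 tK.
have [C1 K1C stC1] := stabilization (tame_terminating nB t1).
have [C2 K2C stC2] := stabilization (tame_terminating nB t2).
have C1E := CP _ (fires_trans KK1 K1C) stC1.
have C2E := CP _ (fires_trans KK2 K2C) stC2.
have := support_fires nB t1 K1C K1g; rewrite C1E -C2E => C2g.
have gf0 : g != f0 by apply: contraTneq ng => ->; rewrite /dist !subrr.
have : C2 g <= (dist g g)%:Z.
  (* The distance to [g] is 1-Lipschitz, at least [n] next to [f0] because [n < dist f0 g], and zero
     at [g]. *)
  apply: (upper_fires (U := fun f => (dist f g)%:Z) nB _ _ t2 K2C K2U gf0).
    by move=> f h; rewrite adjacentE /dist; lia.
  by move=> h; rewrite adjacentE; move: ng; rewrite /dist; lia.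
by rewrite /dist !subrr; lia.
Qed.

Definition corner (f0 : face) : face := (f0.1 + 1, f0.2 + 1).

(* Distances to f0 do not grow when the corner is deleted. *)
Lemma closer_neighbour (f0 z f : face) : z = f0 \/ z = corner f0 ->
  (2 <= dist f0 f)%N ->
  exists g, [/\ adjacent g f, dist f0 f = (dist f0 g).+1 & g != z].
Proof.
case: f0 z f => [a b] [u v] [c d] /=; rewrite /corner /dist /= => zE d2.
pose x := if a < c then c - 1 else c + 1.
pose y := if b < d then d - 1 else d + 1.
(* Step vertically towards [f0], except in the row of [f0] and straight above the corner, where that
   step would move away or hit the corner. *)
have [e|] := boolP ((d == b) || ((d == b + 1 + 1) && (c == a + 1))).
  exists (x, d); rewrite adjacentE /dist /x /= xpair_eqE.
  by case: zE => -[-> ->]; case: ifP; split; lia.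
move=> e; exists (c, y); rewrite adjacentE /dist /y /= xpair_eqE.
by case: zE => -[-> ->]; case: ifP; split; lia.
Qed.

(** Induction on the distance along a shortest path avoiding [z]: the weight drops by at most 1 per
    step. Taking [z = f0] covers stable configurations, [z = corner f0] the run with a frozen
    corner. *)
Lemma stable_lower_bound (f0 z : face) (n : nat) (K : config) :
  z = f0 \/ z = corner f0 ->
  (forall g, adjacent f0 g -> n%:Z <= K g) ->
  (forall f g, adjacent f g -> f != f0 -> g != f0 -> f != z -> g != z ->
     K f <= K g + 1) ->
  forall f, f != f0 -> f != z -> n%:Z - (dist f0 f)%:Z + 1 <= K f.
Proof.
move=> zP Kn KL f; move e: (dist f0 f) => d.
elim: d f e => [|d IH] f e ff0 fz.
  move: e ff0; case: (f0) (f) => [a b] [a' b']; rewrite xpair_eqE /dist /=; lia.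
have [d0|d0] := posnP d.
  by have := Kn f; rewrite adjacentE e d0; lia.
have [|g [gf eg gz]] := closer_neighbour (f := f) zP; first by lia.
have gf0 : g != f0.
  by apply: contraTneq d0 => g0; move: eg; rewrite e g0 /dist !subrr /=; lia.
by have := IH g _ gf0 gz; have := KL g f gf gf0 ff0 gz fz; lia.
Qed.

Lemma stable_ge_aztec (f0 : face) (n B : nat) (K : config) :
  tame f0 n B K -> stable f0 K -> forall f, aztec f0 n f <= K f.
Proof.
move=> [K0 bK] st f; rewrite aztecE; case: eqP => [->|/eqP ff0]; first by rewrite K0.
rewrite ge_max (proj1 (andP (proj1 (bK f)))) andbT.
apply: (@stable_lower_bound f0 f0) => //; first by left.
  move=> g f0g; rewrite leNgt -K0; apply/negP => lt.
  exact: st (fire_from_marked f0g lt).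
move=> h g hg h0 g0 _ _; rewrite leNgt; apply/negP => lt.
by apply: st (fire_between hg h0 g0 _); lia.
Qed.

Lemma aztec_stable (f0 : face) (n : nat) : stable f0 (aztec f0 n).
Proof.
move=> K'; case=> [f g fg f0' g0'|g fg|g fg]; rewrite !aztecE ?eqxx.
- rewrite (negPf f0') (negPf g0').
  by have := dist_adjacent f0 (etrans (adjacentC g f) fg); lia.
- rewrite eq_sym (negPf (adjacent_neq fg)).
  by move: fg; rewrite adjacentE; lia.
- rewrite eq_sym (negPf (adjacent_neq fg)).
  by move: fg; rewrite adjacentE; lia.
Qed.

(** The weights of Az(n) off [f0] are themselves an admissible upper bound, so [K'] is squeezed. *)
Lemma le_aztec_terminates (f0 : face) (n B : nat) (K K' : config) :
  (n < B)%N -> tame f0 n B K -> (forall f, f != f0 -> K f <= aztec f0 n f) ->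
  fires f0 K K' -> stable f0 K' -> K' = aztec f0 n.
Proof.
move=> nB tK KU KK' st; have tK' := tame_fires nB KK' tK.
apply/fsfunP => f; apply/eqP; rewrite eq_le (stable_ge_aztec tK' st) andbT.
have [->|ff0] := eqVneq f f0; first by rewrite (proj1 tK') aztecE eqxx.
apply: (upper_fires nB _ _ tK KK') => //.
  move=> h g hg h0 g0; rewrite !aztecE (negPf h0) (negPf g0).
  by have := dist_adjacent f0 (etrans (adjacentC g h) hg); lia.
move=> g fg; rewrite !aztecE eq_sym (negPf (adjacent_neq fg)).
by move: fg; rewrite adjacentE; lia.
Qed.

Lemma pulse_tame (f0 : face) (n r : nat) : tame f0 n (n + r).+1 (pulse f0 n r).
Proof.
split=> [|f]; rewrite pulseE; first by rewrite /dist !subrr.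
by case: ifP; lia.
Qed.

Lemma pulse_small_radius (f0 : face) (n r : nat) :
  (r <= 1)%N -> terminates_uniquely_in f0 (pulse f0 n r) (aztec f0 n).
Proof.
move=> r1; have tK := pulse_tame f0 n r; have nB : (n < (n + r).+1)%N by lia.
split; last 1 first.
- move=> K'; apply: (le_aztec_terminates nB tK) => f ff0; rewrite pulseE aztecE (negPf ff0).
  by case: ifP; lia.
- exact/terminating_no_infinite/tame_terminating/tK.
- exact: aztec_stable.
Qed.

(* Fire everything except the corner, which keeps its weight n. *)
Lemma frozen_corner_excess (f0 : face) (n r : nat) :
  (1 <= n)%N -> (2 <= r)%N ->
  exists2 K, fires f0 (pulse f0 n r) K &
    (forall f, aztec f0 n f <= K f) /\ aztec f0 n (corner f0) < K (corner f0).
Proof.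
move=> n1 r2; set z := corner f0; set K0 := pulse f0 n r.
have tK : tame f0 n _ K0 := pulse_tame f0 n r; have nB : (n < (n + r).+1)%N by lia.
have dz : dist f0 z = 2 by rewrite /dist /z /corner /=; lia.
have zf0 : z != f0 by apply: contra_eq_neq dz => ->; rewrite /dist !subrr.
pose R (A C : config) := firing f0 A C /\ C z = A z.
have [|||| K [KK [tK' Kz] noR]] :=
  @restricted_stabilization f0 R (fun A => tame f0 n (n + r).+1 A /\ A z = n%:Z) K0.
- by move=> A C [].
- move=> A C [tA Az] [s ->]; split=> //; exact: tameS s.
- exact: tame_terminating tK.
- by split=> //; rewrite pulseE dz r2.
exists K => //; have [Kf0 bK] := tK'.
have az : aztec f0 n z = n%:Z - 1 by rewrite aztecE (negPf zf0) dz; lia.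
split; last by rewrite Kz az; lia.
move=> f; have [->|fz] := eqVneq f z; first by rewrite Kz az; lia.
rewrite aztecE; case: eqP => [->|/eqP ff0]; first by rewrite Kf0.
rewrite ge_max (proj1 (andP (proj1 (bK f)))) andbT.
apply: (@stable_lower_bound f0 z) => //; first by right.
  move=> g f0g; rewrite leNgt -Kf0; apply/negP => lt.
  apply: noR; split; first exact: fire_from_marked f0g lt.
  rewrite fsfun_withE; case: eqP f0g => // <-.
  by rewrite adjacentE dz.
move=> h g hg h0 g0 hz gz; rewrite leNgt; apply/negP => lt.
apply: noR; split; first by apply: fire_between hg h0 g0 _; lia.
by rewrite [LHS]moveE ?adjacent_neq // ![z == _]eq_sym (negPf hz) (negPf gz) subr0 addr0.
Qed.

(** * One-dimensional spreading *)

(* The weights along a ray. Two plateaus strictly between the levels 0 and n are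
   separated by a cliff, so that a stable slope is a staircase with at most one
   repeated step; n and 0 are excluded because the initial block n, ..., n, 0, ...
   is flat there. *)
Record slope (n : nat) (T : int) (c : nat -> int) : Prop := Slope {
  slope_ge0 : forall i, 0 <= c i;
  slope_mono : forall i, c i.+1 <= c i;
  slope_sum : forall N, \sum_(i < N) c i <= T;
  slope_cliff : forall i j, (i < j)%N ->
    c i = c i.+1 -> c i < n%:Z -> c j = c j.+1 -> 0 < c j ->
    exists2 k, (i < k < j)%N & c k.+1 + 2 <= c k }.

Lemma slope_ext (n : nat) (T : int) (c c' : nat -> int) :
  c =1 c' -> slope n T c -> slope n T c'.
Proof.
move=> E [c0 cm cs cc]; split=> [i|i|N|i j ij]; rewrite -?E //.
  by rewrite (eq_bigr (fun i : 'I_N => c i)) => [|i _]; rewrite ?cs ?E.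
move=> ei li ej lj; have [k kij ck] := cc i j ij ei li ej lj.
by exists k => //; rewrite -!E.
Qed.

(** The move may create a plateau at [t] or destroy the cliff at [t], and leaves no plateau at
    [t - 1] or [t + 1]. Either way a cliff is found on each side of [t]: next to [t] if [c] strictly
    drops there, and otherwise beyond, because [c] itself has a plateau there. *)
Lemma slope_step (n : nat) (T : int) (c c' : nat -> int) (t : nat) :
  (forall i, c i <= n%:Z) ->
  slope n T c -> c t.+1 + 2 <= c t ->
  (forall i, c' i = c i - (i == t)%:Z + (i == t.+1)%:Z) -> slope n T c'.
Proof.
move=> cn [c0 cm cs cc] ct E.
have Et : c' t = c t - 1 by rewrite E eqxx; lia.
have Et1 : c' t.+1 = c t.+1 + 1 by rewrite E eqxx; lia.
have Eo i : i != t -> i != t.+1 -> c' i = c i by move=> /negPf h /negPf h'; rewrite E h h'; lia.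
have left i : (i.+1 < t)%N -> c i = c i.+1 -> c i < n%:Z ->
    exists2 k, (i < k < t)%N & c' k.+1 + 2 <= c' k.
  case: t ct E Et Et1 Eo => // t ct E Et Et1 Eo it ei li.
  have [lt|ge] := ltP (c t.+1) (c t).
    by exists t; rewrite ?Et ?(Eo t); lia.
  have := cm t => ge'; have := c0 t.+2 => ct2.
  have [k kit ck] : exists2 k, (i < k < t)%N & c k.+1 + 2 <= c k.
    by apply: cc => //; lia.
  exists k; first lia.
  by rewrite !Eo; lia.
have right j : (t.+1 < j)%N -> c j = c j.+1 -> 0 < c j ->
    exists2 k, (t < k < j)%N & c' k.+1 + 2 <= c' k.
  move=> tj ej lj.
  have [lt|ge] := ltP (c t.+2) (c t.+1).
    by exists t.+1; rewrite ?Et1 ?(Eo t.+2); lia.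
  have ge' := cm t.+1; have cnt := cn t.
  have [k kit ck] : exists2 k, (t.+1 < k < j)%N & c k.+1 + 2 <= c k.
    by apply: cc => //; lia.
  exists k; first lia.
  by rewrite !Eo; lia.
split.
- move=> i; have := c0 i; have := c0 t.+1; rewrite E; case: eqP => [->|]; lia.
- move=> i; have [->|it] := eqVneq i t; first by rewrite Et Et1; lia.
  have [->|it1] := eqVneq i t.+1; first by rewrite Et1 Eo; [have := cm t.+1; lia | lia | lia].
  rewrite (Eo i) //; have [e|i1t] := eqVneq i.+1 t.
    by rewrite e Et; have := cm i; rewrite e; lia.
  by rewrite Eo //; lia.
- move=> N; apply: le_trans (cs N).
  (* Only the prefix of length [t + 1] loses a chip. *)
  suff: \sum_(i < N) c' i + (N == t.+1)%:Z = \sum_(i < N) c i by lia.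
  elim: N => [|N IH]; first by rewrite !big_ord0.
  by rewrite !big_ord_recr /= -IH E eqSS; ring.
- move=> i j ij ei li ej lj.
  have := cm; have := c0 => d0 dm.
  have nit : i != t.+1.
    by apply/eqP => it; move: ei; rewrite it Et1 Eo; have := dm t.+1; lia.
  have njt : j != t.+1.
    by apply/eqP => it; move: ej; rewrite it Et1 Eo; have := dm t.+1; lia.
  have nit' : i.+1 != t.
    apply/eqP => it; move: ei; rewrite it Et Eo; [|lia|lia].
    by have := dm i; rewrite it; lia.
  have njt' : j.+1 != t.
    apply/eqP => it; move: ej; rewrite it Et Eo; [|lia|lia].
    by have := dm j; rewrite it; lia.
  have [it|nit0] := eqVneq i t.
    have [k kij ck] : exists2 k, (t < k < j)%N & c' k.+1 + 2 <= c' k.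
      by apply: right; [lia | move: ej; rewrite !Eo; lia | move: lj; rewrite Eo; lia].
    by exists k => //; lia.
  rewrite !Eo // in ei li.
  have [jt|njt0] := eqVneq j t.
    by rewrite jt; apply: left => //; lia.
  rewrite !Eo // in ej lj.
  have [k kij ck] := cc i j ij ei li ej lj.
  (* If the old cliff is the one just fired, [left] supplies a replacement. *)
  have [kt|kt] := eqVneq k t.
    have [k' kij' ck'] : exists2 k', (i < k' < t)%N & c' k'.+1 + 2 <= c' k'.
      by apply: left => //; lia.
    by exists k' => //; lia.
  by exists k => //; rewrite !E; lia.
Qed.

Lemma sum_stairs (v N : nat) : (v <= N)%N ->
  2 * \sum_(i < N) (v - i)%N%:Z = v%:Z * (v%:Z + 1).
Proof.
move=> vN; rewrite -(subnKC vN); elim: (N - v)%N => {vN} [|d IH].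
  rewrite addn0; elim: v => [|v IH]; first by rewrite big_ord0; lia.
  rewrite big_ord_recl /= mulrDr.
  by under eq_bigr do rewrite /bump /= subSS; rewrite IH; lia.
by rewrite addnS big_ord_recr /= mulrDr IH; lia.
Qed.

(** Drops of at most 1 from height [v] keep [c] above the staircase, strictly at [x]. *)
Lemma sum_above_stairs (v x : nat) (c : nat -> int) :
  (forall i, 0 <= c i) -> (forall i, c i <= c i.+1 + 1) -> v%:Z <= c 0%N ->
  (v - x)%N%:Z < c x -> v%:Z * (v%:Z + 1) < 2 * \sum_(i < (v + x).+1) c i.
Proof.
move=> c0 cl vc cx; rewrite -(@sum_stairs v (v + x).+1); last by lia.
rewrite ltr_pM2l //.
have cv i : (v - i)%N%:Z <= c i.
  elim: i => [|i IH]; first by rewrite subn0.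
  by have := cl i; have := c0 i.+1; lia.
have lx : (x < (v + x).+1)%N by lia.
rewrite (bigD1 (Ordinal lx)) //= [ltRHS](bigD1 (Ordinal lx)) //=.
by apply: ltr_leD => //; apply: ler_sum => i _.
Qed.

(** Each of the first [x] steps drops by 0 or 1 and the total drop is at most [x - 2], so two steps
    are flat. *)
Lemma two_plateaus (c : nat -> int) (x : nat) :
  (forall i, c i.+1 <= c i) -> (forall i, c i <= c i.+1 + 1) ->
  c 0%N + 2 <= c x + x%:Z ->
  exists i j, [/\ (i < j < x)%N, c i = c i.+1 & c j = c j.+1].
Proof.
move=> cm cl.
have one y : c 0%N + 1 <= c y + y%:Z -> exists2 i, (i < y)%N & c i = c i.+1.
  elim: y => [|y IH] cy; first by lia.
  have [lt|ge] := ltP (c y.+1) (c y).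
    by have [|i iy ei] := IH _; [lia | exists i => //; lia].
  by exists y => //; have := cm y; lia.
elim: x => [|x IH] cx; first by lia.
have [lt|ge] := ltP (c x.+1) (c x).
  by have [|i [j [ij ei ej]]] := IH _; [lia | exists i, j; split=> //; lia].
have [|i ix ei] := one x; first by have := cm x; lia.
by exists i, x; split=> //; [lia | have := cm x; lia].
Qed.

(** Exceeding the staircase at [x] is impossible: if [c 0 >= s], the sum exceeds [T]; if [c 0 < s],
    two plateaus strictly between 0 and [n] occur with no cliff to separate them. *)
Lemma slope_stable_le (n s : nat) (T : int) (c : nat -> int) (x : nat) :
  slope n T c -> (forall i, c i <= c i.+1 + 1) ->
  (s <= n)%N -> 2 * T <= s%:Z * (s%:Z + 1) -> c x <= (s - x)%N%:Z.
Proof.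
move=> [c0 cm cs cc] cl sn Ts; rewrite leNgt; apply/negP => cx.
have [sc|sc] := leP s%:Z (c 0%N).
  by have := sum_above_stairs c0 cl sc cx; have := cs (s + x).+1; lia.
have [|i [j [/andP[ij jx] ei ej]]] := @two_plateaus c x cm cl; first by lia.
have mono a b : (a <= b)%N -> c b <= c a.
  move=> ab; rewrite -(subnKC ab); elim: (b - a)%N => [|d IH]; first by rewrite addn0.
  by rewrite addnS; apply: le_trans (cm _) IH.
have [||k kij] := cc i j ij ei _ ej.
- by have := mono 0%N i; lia.
- by have := mono j x; lia.
by have := cl k; lia.
Qed.

Lemma sum_block (c : int) (m N : nat) :
  \sum_(i < N) (if (i < m)%N then c else 0) = c * (minn N m)%:Z.
Proof.
elim: N => [|N IH]; first by rewrite big_ord0 min0n mulr0.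
rewrite big_ord_recr /= IH; case: ltnP => h.
  by rewrite (minn_idPl h) -addn1 PoszD mulrDr mulr1.
by rewrite (minn_idPr (leqW h)) addr0.
Qed.

Lemma slope_block (n m : nat) (c : nat -> int) :
  (forall i, c i = if (i < m)%N then n%:Z else 0) -> slope n (n%:Z * m%:Z) c.
Proof.
move=> E; split.
- by move=> i; rewrite E; case: ifP; lia.
- by move=> i; rewrite !E; case: ifP; case: ifP; lia.
- move=> N; under eq_bigr do rewrite E.
  by rewrite sum_block; nia.
- by move=> i j ij _; rewrite !E; case: ifP; case: ifP; lia.
Qed.

(** The rays are disjoint, so each outward move changes a single slope, and each ray obeys the
    one-dimensional bound at the end. *)
Lemma spread_along_rays (f0 : face) (n B : nat) (K : config) (I : Type)
    (p : I -> nat -> face) (m s : I -> nat) :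
  (n < B)%N -> tame f0 n B K ->
  (forall l i, adjacent (p l i) (p l i.+1)) ->
  (forall l i, p l i != f0) ->
  (forall l l' i i', p l i = p l' i' -> l = l' /\ i = i') ->
  (forall l i, K (p l i) = if (i < m l)%N then n%:Z else 0) ->
  (forall l, (s l <= n)%N) ->
  (forall l, (2 * (n * m l) <= s l * (s l).+1)%N) ->
  exists K', [/\ fires f0 K K',
     forall l i, K' (p l i) <= (s l - i)%N%:Z &
     forall f, (forall l i, f != p l i) -> K' f = K f].
Proof.
move=> nB tK padj pf0 pinj Kp sn ms.
pose R (A C : config) := exists l t, A (p l t.+1) + 2 <= A (p l t)
  /\ C = move A (p l t) (p l t.+1).
pose P (A : config) := [/\ tame f0 n B A,
  forall l, slope n (n%:Z * (m l)%:Z) (fun i => A (p l i)) &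
  forall f, (forall l i, f != p l i) -> A f = K f].
have Rf A C : R A C -> firing f0 A C.
  by move=> [l [t [lt ->]]]; apply: fire_between.
have [||||K' [KK' [tK' sl off] noR]] := @restricted_stabilization f0 R P K.
- exact: Rf.
- move=> A C [tA sA oA] RAC; split; first exact: tameS (Rf _ _ RAC).
    case: RAC => l [t [lt ->]] l'.
    have nlt := adjacent_neq (padj l t).
    (* [I] is an arbitrary type, so equality of ray indices is decided classically. *)
    have [e|ne] := classic (l' = l).
      subst l'; apply: (slope_step (t := t) _ (sA l) lt) => i.
        by have [_ /(_ (p l i))] := tA; lia.
      rewrite moveE //; congr (_ - (nat_of_bool _)%:Z + (nat_of_bool _)%:Z);
        by apply/eqP/eqP => [/pinj[]|->].
    apply: slope_ext (sA l') => i; rewrite moveE //.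
    rewrite (_ : (p l' i == p l t) = false); last by apply/eqP => /pinj[].
    rewrite (_ : (p l' i == p l t.+1) = false); last by apply/eqP => /pinj[].
    by rewrite subr0 addr0.
  case: RAC => l [t [lt ->]] f fp.
  by rewrite moveE ?adjacent_neq // (negPf (fp l t)) (negPf (fp l t.+1)) subr0 addr0 oA.
- exact: tame_terminating tK.
- by split=> // l; apply: slope_block.
exists K'; split=> // l i.
apply: (@slope_stable_le n (s l) _ (fun i => K' (p l i)) i (sl l)) => //; last by have := ms l; lia.
move=> t; rewrite leNgt; apply/negP => lt.
by apply: (noR (move K' (p l t) (p l t.+1))); exists l, t; split=> //; lia.
Qed.

(** * Reaching the Aztec diamond *)

(* Every face other than f0 lies on exactly one ray: the quadrants
   { x >= 1, y >= 0 } and its three rotations are cut into lines. *)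
Definition pinwheel (f0 : face) (l : bool * bool * nat) (i : nat) : face :=
  let: (h, e, y) := l in
  let sg : int := if e then 1 else -1 in
  if h then (f0.1 + sg * i.+1%:Z, f0.2 + sg * y%:Z)
  else (f0.1 - sg * y%:Z, f0.2 + sg * i.+1%:Z).

Lemma dist_pinwheel (f0 : face) (l : bool * bool * nat) (i : nat) :
  dist f0 (pinwheel f0 l i) = (i + l.2).+1.
Proof. by case: l => [[[] []] y]; rewrite /pinwheel /dist /=; lia. Qed.

Lemma pinwheel_cover (f0 f : face) : f != f0 -> exists l i, f = pinwheel f0 l i.
Proof.
case: f0 f => [a b] [c d]; rewrite xpair_eqE => ne.
have [h1|h1] := boolP ((a < c) && (b <= d)).
  by exists (true, true, absz (d - b)%R), (absz (c - a - 1)%R); congr pair => /=; lia.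
have [h2|h2] := boolP ((c < a) && (d <= b)).
  by exists (true, false, absz (d - b)%R), (absz (a - c - 1)%R); congr pair => /=; lia.
have [h3|h3] := boolP ((b < d) && (c <= a)).
  by exists (false, true, absz (c - a)%R), (absz (d - b - 1)%R); congr pair => /=; lia.
by exists (false, false, absz (c - a)%R), (absz (b - d - 1)%R); congr pair => /=; lia.
Qed.

Lemma pulse_reaches_aztec (f0 : face) (n r : nat) :
  (r <= uphalf n)%N -> can_terminate_in f0 (pulse f0 n r) (aztec f0 n).
Proof.
move=> rn; have tK := pulse_tame f0 n r; have nB : (n < (n + r).+1)%N by lia.
(* Line [y] starts at distance [y + 1]: it has [r - y] full faces, and Az(n) restricted to it is the
   staircase from [n - y]. *)
have [||||||K [KK Kle _]] := @spread_along_rays f0 n _ _ _ (pinwheel f0)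
  (fun l => r - l.2)%N (fun l => n - l.2)%N nB tK.
- by move=> [[[] []] y] i; rewrite adjacentE /dist /pinwheel /=; lia.
- move=> l i; apply: contra_eq_neq (dist_pinwheel f0 l i) => ->.
  by rewrite /dist !subrr.
- case: f0 {tK} => [a b] [[[] []] y] [[[] []] y'] i i';
    rewrite /pinwheel /= => -[e1 e2]; try (exfalso; lia);
    by split; [congr pair | ]; lia.
- by move=> l i; rewrite pulseE dist_pinwheel; case: ifP; case: ifP; lia.
- by move=> l; lia.
(* From [2 r <= n + 1] follows [2 n (r - y) <= n (n + 1) - 2 n y], and [(n - y) (n - y + 1)] exceeds
   the right side by [y (y - 1)]. *)
- move=> [q y] /=; have [yr|ry] := leqP y r; last by rewrite (_ : (r - y)%N = 0%N) ?muln0 //; lia.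
  have h : (n * (2 * (r - y)) + n * (2 * y) <= n * n.+1)%N.
    by rewrite -mulnDr leq_mul2l; lia.
  have yn : (y <= n)%N by lia.
  have e : ((n - y) * (n - y).+1 + n * (2 * y) = n * n.+1 + y * y.-1)%N.
    rewrite -{2 3 4 5}(subnK yn); move: (n - y)%N => u.
    by case: (y) => [|y'] /=; nia.
  by lia.
have tK' := tame_fires nB KK tK.
have [C KC stC] := stabilization (tame_terminating nB tK').
suff <- : C = aztec f0 n by split=> //; apply: fires_trans KC.
apply: (le_aztec_terminates nB tK' _ KC stC) => f ff0.
have [l [i fE]] := pinwheel_cover ff0.
have := Kle l i; rewrite aztecE (negPf ff0) fE dist_pinwheel; lia.
Qed.

Lemma pulse_exceeds_aztec (f0 : face) (n r : nat) :
  (1 <= n)%N -> (2 <= r)%N ->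
  can_terminate_in f0 (pulse f0 n r) (aztec f0 n) ->
  ~ terminates_uniquely f0 (pulse f0 n r).
Proof.
move=> n1 r2 [KA stA] [C [_ _ CP]].
have tK := pulse_tame f0 n r; have nB : (n < (n + r).+1)%N by lia.
have [K KK [Kge Kz]] := frozen_corner_excess f0 n1 r2.
have tK' := tame_fires nB KK tK.
have [C' KC stC] := stabilization (tame_terminating nB tK').
have := chips_fires nB KC tK'.
rewrite (CP _ (fires_trans KK KC) stC) -(CP _ KA stA) => /=.
apply/negP; rewrite -ltNge.
have zb : corner f0 \in box f0 (n + r).+1.
  by apply: in_box; rewrite /dist /corner /=; lia.
rewrite /chips !(bigD1_seq _ zb (uniq_box _ _)) /=.
by apply: ltr_leD => //; apply: ler_sum.
Qed.

(** * Walls and windows *)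

(** Fire only inside the sets [s l]. By disjointness a move with both faces in one set meets no
    other, so every sum is preserved. *)
Lemma local_stabilization (f0 : face) (n B : nat) (K : config) (I : Type)
    (s : I -> seq face) :
  (n < B)%N -> tame f0 n B K ->
  (forall l, uniq (s l)) -> (forall l, f0 \notin s l) ->
  (forall l l' f, f \in s l -> f \in s l' -> l = l') ->
  exists K', [/\ fires f0 K K',
    forall l, \sum_(f <- s l) K' f = \sum_(f <- s l) K f,
    forall f, (forall l, f \notin s l) -> K' f = K f &
    forall l f g, f \in s l -> g \in s l -> adjacent f g -> K' f <= K' g + 1].
Proof.
move=> nB tK us s0 sI.
pose R (A C : config) := exists l f g, [/\ f \in s l, g \in s l, adjacent f g,
  A g + 2 <= A f & C = move A f g].
pose P (A : config) := [/\ tame f0 n B A,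
  forall l, \sum_(f <- s l) A f = \sum_(f <- s l) K f &
  forall f, (forall l, f \notin s l) -> A f = K f].
have Rf A C : R A C -> firing f0 A C.
  move=> [l [f [g [fl gl fg lt ->]]]].
  by apply: fire_between => //; apply: contraNneq (s0 l) => <-.
have [||||K' [KK' [tK' sl off] noR]] := @restricted_stabilization f0 R P K.
- exact: Rf.
- move=> A C [tA sA oA] RAC; split; first exact: tameS (Rf _ _ RAC).
    case: RAC => l [f [g [fl gl fg lt ->]]] l'.
    rewrite sum_move ?adjacent_neq // sA.
    have -> : (f \in s l') = (g \in s l').
      by apply/idP/idP => h; [rewrite -(sI l l' f) | rewrite -(sI l l' g)].
    by rewrite subrK.
  case: RAC => l [f [g [fl gl fg lt ->]]] h hl.
  rewrite moveE ?adjacent_neq //.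
  have -> : (h == f) = false by apply: contraNF (hl l) => /eqP ->.
  have -> : (h == g) = false by apply: contraNF (hl l) => /eqP ->.
  by rewrite subr0 addr0 oA.
- exact: tame_terminating tK.
- by [].
exists K'; split=> // l f g fl gl fg; rewrite leNgt; apply/negP => lt.
by apply: (noR (move K' f g)); exists l, f, g; split=> //; lia.
Qed.

Lemma sum_iota (F : nat -> int) (N : nat) : \sum_(i <- iota 0 N) F i = \sum_(i < N) F i.
Proof. by rewrite -[X in iota 0 X]subn0 -/(index_iota 0 N) big_mkord. Qed.

(* If g stayed empty, the stable window would lie below 0, 1, ..., n - 1. *)
Lemma fill_window (f0 : face) (n B : nat) (K : config) (g : face) :
  (n < B)%N -> tame f0 n B K ->
  (forall i, (i < n)%N -> (g.1 - i%:Z, g.2) != f0) ->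
  (n * (n - 1))%N%:Z < 2 * \sum_(i < n) K (g.1 - i%:Z, g.2) ->
  exists2 K', fires f0 K K' & 1 <= K' g.
Proof.
move=> nB tK wf0 big; pose q (i : nat) : face := (g.1 - i%:Z, g.2).
have qI : injective q by move=> i j [] ; lia.
have sumq A : \sum_(f <- [seq q i | i <- iota 0 n]) A f = \sum_(i < n) A (q i) :> int.
  by rewrite big_map sum_iota.
have [|||K' [KK' sumK _ lip]] := @local_stabilization f0 n B K unit
  (fun => [seq q i | i <- iota 0 n]) nB tK.
- by move=> _; rewrite map_inj_uniq ?iota_uniq.
- move=> _; apply/mapP => -[i]; rewrite mem_iota add0n => /andP[_ lt] e.
  by have := wf0 i lt; rewrite -/(q i) -e eqxx.
- by case; case.
exists K' => //; rewrite leNgt; apply/negP => lt.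
have K'i i : (i < n)%N -> K' (q i) <= i%:Z.
  elim: i => [_|i IH lti].
    by rewrite /q subr0 -surjective_pairing; lia.
  have ad : adjacent (q i.+1) (q i) by rewrite adjacentE /dist /q /=; lia.
  have qs j : (j < n)%N -> q j \in [seq q i | i <- iota 0 n].
    by move=> jn; rewrite map_f // mem_iota.
  by have := lip tt _ _ (qs _ lti) (qs _ (ltnW lti)) ad; have := IH (ltnW lti); lia.
suff le : 2 * \sum_(i < n) K' (q i) <= (n * (n - 1))%N%:Z.
  by move: big; rewrite ltNge -/(q _) -(sumq K) -(sumK tt) sumq le.
have : \sum_(i < n) K' (q i) <= \sum_(i < n) (i : nat)%:Z by apply: ler_sum => i _; apply: K'i.
suff : 2 * \sum_(i < n) (i : nat)%:Z = (n * (n - 1))%N%:Z by lia.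
elim: (n) => [|m IH]; first by rewrite big_ord0.
by rewrite big_ord_recr /= mulrDr IH; nia.
Qed.

(** * Sums over intervals and cones *)

Lemma face_eqE (f g : face) : (f == g) = (f.1 == g.1) && (f.2 == g.2).
Proof. by case: f g => [a b] [c d]; rewrite xpair_eqE. Qed.

Lemma sum_const_int (k : nat) (c : int) : \sum_(i < k) c = c * k%:Z.
Proof. by rewrite sumr_const card_ord -mulr_natr natz. Qed.

Lemma sum_around (g : nat -> int) (a b : nat) :
  \sum_(i < a + b) g (absz (i%:Z - a%:Z)) =
  \sum_(i < a) g i.+1 + \sum_(i < b) g i.
Proof.
rewrite big_split_ord /=; congr (_ + _).
  rewrite (reindex_inj rev_ord_inj) /=; apply: eq_bigr => i _; congr g.
  by have := ltn_ord i; lia.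
by apply: eq_bigr => i _; congr g; lia.
Qed.

Lemma sum_cone (v a b : nat) : (v <= a.+1)%N -> (v <= b)%N ->
  \sum_(i < a + b) (v - absz (i%:Z - a%:Z))%N%:Z = v%:Z ^+ 2.
Proof.
move=> va vb; rewrite (sum_around (fun t => (v - t)%N%:Z)).
have h1 := sum_stairs vb.
have h2 : 2 * \sum_(i < a) (v - i.+1)%N%:Z = v.-1%:Z * (v.-1%:Z + 1).
  rewrite -(@sum_stairs v.-1 a); last by lia.
  by congr (2 * _); apply: eq_bigr => i _; congr Posz; lia.
by case: v {va vb} h1 h2 => [|v] /=; nia.
Qed.

(** Two-sided form of the staircase bound: a 1-Lipschitz profile of height [v] at [a] lies above the
    cone there, whose sum is [v^2]. *)
Lemma sum_above_cone (c : nat -> int) (v N a : nat) :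
  (forall i, (i < N)%N -> 0 <= c i) ->
  (forall i, (i.+1 < N)%N -> c i <= c i.+1 + 1 /\ c i.+1 <= c i + 1) ->
  v%:Z <= c a -> (v <= a.+1)%N -> (a + v <= N)%N -> (a < N)%N ->
  v%:Z ^+ 2 <= \sum_(i < N) c i.
Proof.
move=> c0 cl vc va avN aN.
rewrite -(@sum_cone v a (N - a)); [|by []|by lia].
rewrite subnKC; last exact: ltnW.
apply: ler_sum => -[i iN] _ /=.
have right d : (a + d < N)%N -> (v - d)%N%:Z <= c (a + d)%N.
  elim: d => [|d IH] dN; first by rewrite addn0 subn0.
  have := IH _; have := cl (a + d)%N; have := c0 (a + d.+1)%N.
  by rewrite addnS; lia.
have left d : (d <= a)%N -> (v - d)%N%:Z <= c (a - d)%N.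
  elim: d => [|d IH] dN; first by rewrite !subn0.
  have := IH _; have := cl (a - d.+1)%N; have := c0 (a - d.+1)%N.
  rewrite (_ : (a - d.+1).+1 = (a - d)%N); lia.
have [le|lt] := leqP a i.
  by have := right (i - a)%N; rewrite subnKC //; lia.
by have := left (a - i)%N; rewrite subKn; lia.
Qed.

(** * Filling a face or walling it off *)

(** The inner half of the window lies in the pulse and holds [2 k^2] chips, more than
    [k (2 k - 1)]. *)
Lemma pulse_fill_even (f0 : face) (k r : nat) : (0 < k)%N -> (k < r)%N ->
  exists2 K, fires f0 (pulse f0 (k + k) r) K & 1 <= K (f0.1 + (r + k)%N%:Z, f0.2).
Proof.
move=> k0 kr.
apply: (fill_window _ (pulse_tame f0 (k + k) r)) => /=; first by lia.
  by move=> i ik; rewrite face_eqE /=; lia.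
rewrite big_split_ord /= mulrDr.
have le0 : 0 <= \sum_(i < k) pulse f0 (k + k) r (f0.1 + (r + k)%N%:Z - i%:Z, f0.2).
  by apply: sumr_ge0 => i _; rewrite pulseE; case: ifP; lia.
rewrite [X in _ < _ + 2 * X](eq_bigr (fun => (k + k)%N%:Z)) => [|i _]; last first.
  by rewrite pulseE /dist /= ifT //; have := ltn_ord i; lia.
rewrite sum_const_int; move: (\sum_(i < k) _) le0 => S le0.
have -> : (k + k - 1 = k + k.-1)%N by lia.
by case: k k0 {kr} => // k _ /=; nia.
Qed.

(* The window in the row of ordinate 1 is one chip short of reaching the target,
   so a chip is first fired into it from the tip of the pulse. *)
Lemma pulse_fill_odd (f0 : face) (k r : nat) : (0 < k)%N -> (k.+1 < r)%N ->
  exists2 K, fires f0 (pulse f0 (k + k.+1) r) K &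
    1 <= K (f0.1 + (r + k)%N%:Z, f0.2 + 1).
Proof.
move=> k0 kr; set n := (k + k.+1)%N.
pose f : face := (f0.1 + r%:Z, f0.2); pose g : face := (f0.1 + r%:Z, f0.2 + 1).
have fg : adjacent f g by rewrite adjacentE /dist /f /g /=; lia.
have s : firing f0 (pulse f0 n r) (move (pulse f0 n r) f g).
  apply: fire_between => //.
  - by rewrite face_eqE /=; lia.
  - by rewrite face_eqE /=; lia.
  - rewrite !pulseE /dist /f /g /= ifF ?ifT; lia.
have nB : (n < (n + r).+1)%N by lia.
have tK := tameS nB (pulse_tame f0 n r) s.
suff [K KK Kg] : exists2 K, fires f0 (move (pulse f0 n r) f g) K &
    1 <= K (f0.1 + (r + k)%N%:Z, f0.2 + 1).
  by exists K => //; apply: fires_trans KK; apply: fires1.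
apply: (fill_window nB tK) => /=.
  by move=> i ik; rewrite face_eqE /=; lia.
have [_ bK] := tK.
rewrite big_split_ord /= big_ord_recl /=.
have le0 : 0 <= \sum_(i < k) move (pulse f0 n r) f g
    (f0.1 + (r + k)%N%:Z - i%:Z, f0.2 + 1).
  by apply: sumr_ge0 => i _; have := bK (f0.1 + (r + k)%N%:Z - i%:Z, f0.2 + 1); lia.
have nfg := adjacent_neq fg.
have -> : (f0.1 + (r + k)%N%:Z - (k + 0)%N%:Z, f0.2 + 1) = g.
  by rewrite /g; congr pair; lia.
rewrite moveE // eqxx eq_sym (negPf nfg).
have -> : pulse f0 n r g = 0 by rewrite pulseE ifF // /dist /g /=; lia.
rewrite [X in _ < 2 * (_ + (_ + X))](eq_bigr (fun => n%:Z)) => [|i _]; last first.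
  have ik := ltn_ord i; rewrite moveE // pulseE ifT; last by rewrite /dist /bump /=; lia.
  have -> : ((f0.1 + (r + k)%N%:Z - (k + bump 0 i)%N%:Z, f0.2 + 1) == f) = false.
    by rewrite face_eqE /bump /=; lia.
  have -> : ((f0.1 + (r + k)%N%:Z - (k + bump 0 i)%N%:Z, f0.2 + 1) == g) = false.
    by rewrite face_eqE /bump /=; lia.
  by rewrite subr0 addr0.
rewrite sum_const_int; move: (\sum_(i < k) _) le0 => S le0.
by rewrite /n addnS subn1 /=; nia.
Qed.

(* Each ray starts k faces before the edge of the pulse, where it carries exactly
   the n(n + 1)/2 chips of the staircase n, n - 1, ..., 1. *)
Lemma pulse_wall_odd (f0 : face) (k r : nat) : (k.+1 < r)%N ->
  exists2 K, fires f0 (pulse f0 (k + k.+1) r) K &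
    forall f, f != f0 -> K f <= (dist f (f0.1 + (r + k)%N%:Z, f0.2 + 1))%:Z.
Proof.
move=> kr; set n := (k + k.+1)%N.
have nB : (n < (n + r).+1)%N by lia.
(* In rows farther out, every face of the pulse is already at distance at least [n] from the
   target. *)
pose I := {y : int | (4 * absz y <= n.+1)%N}.
pose p (y : I) (i : nat) : face :=
  (f0.1 + r%:Z - (absz (sval y))%:Z - k%:Z + i%:Z, f0.2 + sval y).
have [||||||K [KK Kle Koff]] := @spread_along_rays f0 n _ _ I p
  (fun => k.+1) (fun => n) nB (pulse_tame f0 n r).
- by move=> y i; rewrite adjacentE /dist /p /=; lia.
- move=> [y yn] i; rewrite face_eqE /=; lia.
- move=> [y yn] [y' yn'] i i' /= [] e1 e2.
  have e : y = y' by lia.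
  by subst y'; split; [apply: val_inj | lia].
- by move=> [y yn] i; rewrite pulseE /dist /p /=; case: ifP; case: ifP; lia.
- by [].
- by move=> _; rewrite /n; nia.
exists K => // -[x y] ff0; rewrite /dist /=.
have [yn|yn] := boolP (4 * absz (y - f0.2) <= n.+1)%N; last first.
  rewrite Koff; last first.
    by move=> [y' yn'] i; rewrite face_eqE /=; lia.
  by rewrite pulseE /dist /=; case: ifP; lia.
have [xl|xl] := lerP (f0.1 + r%:Z - (absz (y - f0.2))%:Z - k%:Z) x; last first.
  rewrite Koff; last first.
    by move=> [y' yn'] i; rewrite face_eqE /=; lia.
  by rewrite pulseE /dist /=; case: ifP; lia.
have := Kle (exist _ (y - f0.2) yn)
  (absz (x - (f0.1 + r%:Z - (absz (y - f0.2))%:Z - k%:Z))%R).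
rewrite /p /= (_ : (_, _) = (x, y)); last by congr pair; lia.
(* At step [i] of row [y] the distance to the target is at least
   [2 k + |y| + |y - 1| - i >= n - i]. *)
by move/le_trans; apply; rewrite /n; lia.
Qed.

(* The column at abscissa r - j holds (2 j + 1) n chips. Violating the bound after
   vertical spreading would need (k + j + 1)^2 chips, which is more. *)
Lemma pulse_wall_even (f0 : face) (k r : nat) : (k < r)%N ->
  exists2 K, fires f0 (pulse f0 (k + k) r) K &
    forall f, f != f0 -> K f <= (dist f (f0.1 + (r + k)%N%:Z, f0.2))%:Z.
Proof.
move=> kr; set n := (k + k)%N; pose L := (r + n + n)%N.
have nB : (n < (n + r).+1)%N by lia.
have tK := pulse_tame f0 n r.
pose q (j i : nat) : face := (f0.1 + r%:Z - j%:Z, f0.2 + i%:Z - L%:Z).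
have qI j : injective (q j) by move=> i i' []; lia.
pose s (j : 'I_k) := [seq q j i | i <- iota 0 (L + L.+1)].
have in_s (j : 'I_k) i : (i < L + L.+1)%N -> q j i \in s j.
  by move=> iL; rewrite map_f // mem_iota.
have sP (j : 'I_k) (f : face) : f \in s j -> f.1 = f0.1 + r%:Z - (j : nat)%:Z.
  by move=> /mapP[i _ ->].
have [|||K [KK Ksum Koff Klip]] := @local_stabilization f0 n _ _ _ s nB tK.
- by move=> j; rewrite map_inj_uniq ?iota_uniq.
- move=> j; apply/negP => /sP; have := ltn_ord j; lia.
- by move=> j j' f /sP e /sP e'; apply: val_inj => /=; lia.
exists K => // -[x y] ff0.
have [_ bK] := tame_fires nB KK tK.
have [xr|xr] := lerP (f0.1 + r%:Z + 1) x.
  rewrite Koff; first by rewrite pulseE /dist /=; case: ifP; lia.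
  by move=> j; apply/negP => /sP /=; lia.
(* Left of the columns the distance to the target is at least [2 k = n]. *)
have [xl|xl] := lerP x (f0.1 + r%:Z - k%:Z).
  by have := bK (x, y); rewrite /dist /= /n; lia.
have [j xE] : exists j : 'I_k, x = f0.1 + r%:Z - (j : nat)%:Z.
  have jk : (absz (f0.1 + r%:Z - x)%R < k)%N by lia.
  by exists (Ordinal jk) => /=; lia.
have jk := ltn_ord j.
pose v := (k + j + absz (y - f0.2)%R).+1.
have -> : dist (x, y) (f0.1 + (r + k)%N%:Z, f0.2) = v.-1.
  by rewrite /dist /v /=; lia.
rewrite leNgt; apply/negP => Kv.
have vn : (v <= n)%N by have := bK (x, y); lia.
have := Ksum j; rewrite /s !big_map !sum_iota => {}Ksum.
have Psum : \sum_(i < L + L.+1) pulse f0 n r (q j i) = n%:Z * (j + j.+1)%N%:Z.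
  under eq_bigr => i _.
    rewrite pulseE (_ : (dist _ _ <= r)%N = (absz (i%:Z - L%:Z)%R < j.+1)%N); last first.
      by rewrite /dist /q /=; lia.
    over.
  rewrite (sum_around (fun t => if (t < j.+1)%N then n%:Z else 0)).
  under eq_bigr do rewrite ltnS.
  by rewrite !sum_block -mulrDr /L /n; congr (_ * _); lia.
suff : v%:Z ^+ 2 <= n%:Z * (j + j.+1)%N%:Z.
  have : (k + j).+1%:Z ^+ 2 <= v%:Z ^+ 2 by rewrite lerXn2r ?nnegrE // /v; lia.
  (* The difference is [(k - j)^2 + 2 j + 1]. *)
  suff : n%:Z * (j + j.+1)%N%:Z < (k + j).+1%:Z ^+ 2 by lia.
  by rewrite /n; nia.
rewrite -Psum -Ksum.
apply: (@sum_above_cone (fun i => K (q j i)) v _ (absz (y - f0.2 + L%:Z)%R)).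
- by move=> i _; have := bK (q j i); lia.
- move=> i iL; split; apply: (Klip j); rewrite ?in_s ?(ltnW iL) //.
    by rewrite adjacentE /dist /q /=; lia.
  by rewrite adjacentE /dist /q /=; lia.
- rewrite (_ : q j _ = (x, y)); first by rewrite /v; lia.
  by rewrite /q xE; congr pair; lia.
- by rewrite /L; lia.
- by rewrite /L; lia.
- by rewrite /L; lia.
Qed.

Lemma pulse_not_unique (f0 : face) (n r : nat) :
  (2 <= n)%N -> (uphalf n < r)%N -> ~ terminates_uniquely f0 (pulse f0 n r).
Proof.
move=> n2 nr; have tK := pulse_tame f0 n r; have nB : (n < (n + r).+1)%N by lia.
have [n_odd|n_even] := boolP (odd n).
  pose k := n./2; have nE : n = (k + k.+1)%N by lia.
  have [k0 kr] : (0 < k)%N /\ (k.+1 < r)%N by lia.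
  have [K1 KK1 K1g] := pulse_fill_odd f0 k0 kr.
  have [K2 KK2 K2U] := pulse_wall_odd f0 kr.
  rewrite -nE in KK1 KK2; apply: (not_unique_by_support nB tK _ KK1 K1g KK2 K2U).
  by rewrite /dist /=; lia.
pose k := n./2; have nE : n = (k + k)%N by lia.
have [k0 kr] : (0 < k)%N /\ (k < r)%N by lia.
have [K1 KK1 K1g] := pulse_fill_even f0 k0 kr.
have [K2 KK2 K2U] := pulse_wall_even f0 kr.
rewrite -nE in KK1 KK2; apply: (not_unique_by_support nB tK _ KK1 K1g KK2 K2U).
by rewrite /dist /=; lia.
Qed.

(** * Counting chips *)

Lemma sum_sqr_stairs (v N : nat) : (v <= N)%N ->
  6 * \sum_(i < N) (v - i)%N%:Z ^+ 2 = v%:Z * (v%:Z + 1) * (2 * v%:Z + 1).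
Proof.
move=> vN; rewrite -(subnKC vN); elim: (N - v)%N => {vN} [|d IH].
  rewrite addn0; elim: v => [|v IH]; first by rewrite big_ord0; lia.
  rewrite big_ord_recl /= mulrDr.
  by under eq_bigr do rewrite /bump /= subSS; rewrite IH; nia.
rewrite addnS big_ord_recr /= mulrDr IH.
by rewrite (_ : (v - (v + d))%N = 0%N); lia.
Qed.

Lemma sum_box (f0 : face) (B : nat) (F : face -> int) :
  \sum_(f <- box f0 B) F f = \sum_(i < B + B.+1) \sum_(j < B + B.+1)
    F (f0.1 + i%:Z - B%:Z, f0.2 + j%:Z - B%:Z).
Proof.
rewrite /box (_ : (2 * B).+1 = (B + B.+1)%N); last by lia.
rewrite big_allpairs_dep sum_iota; apply: eq_bigr => i _; exact: sum_iota.
Qed.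

(** The column at horizontal offset [t] is a cone of height [v - t], with sum [(v - t)^2]; adding
    these squares gives the octahedral number. *)
Lemma sum_box_cone (f0 : face) (v B : nat) : (v <= B.+1)%N ->
  3 * \sum_(f <- box f0 B) (v - dist f0 f)%N%:Z = v%:Z * (2 * v%:Z ^+ 2 + 1).
Proof.
move=> vB; rewrite sum_box.
under eq_bigr => i _.
  under eq_bigr => j _.
    rewrite (_ : (v - _)%N = ((v - absz (i%:Z - B%:Z)%R) - absz (j%:Z - B%:Z)%R)%N); last first.
      by rewrite /dist /=; lia.
    over.
  rewrite sum_cone; [|lia|lia].
  over.
rewrite (sum_around (fun t => (v - t)%N%:Z ^+ 2)).
have h1 := sum_sqr_stairs vB.
have h2 : 6 * \sum_(i < B) (v - i.+1)%N%:Z ^+ 2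
    = v.-1%:Z * (v.-1%:Z + 1) * (2 * v.-1%:Z + 1).
  rewrite -(@sum_sqr_stairs v.-1 B); last by lia.
  by congr (6 * _); apply: eq_bigr => i _; congr (Posz _ ^+ 2); lia.
move: (\sum_(i < B) _) (\sum_(i < B.+1) _) h1 h2 => S1 S2 h1 h2.
apply: (@mulfI _ 2) => //.
rewrite (_ : 2 * (3 * (S1 + S2)) = 6 * S1 + 6 * S2); last by ring.
rewrite h1 h2; case: (v) => [|u] /=; first by ring.
by rewrite -[u.+1]addn1 PoszD; ring.
Qed.

(** Az(n) is the cone of height [n + 1] with one chip removed at [f0]. *)
Lemma chips_aztec (f0 : face) (n B : nat) : (n <= B)%N ->
  3 * chips f0 B (aztec f0 n) <= n.+1%:Z * (2 * n.+1%:Z ^+ 2 + 1).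
Proof.
move=> nB; rewrite -(@sum_box_cone f0 n.+1 B) // ler_pM2l //.
by apply: ler_sum => f _; rewrite aztecE; case: eqP => [->|_]; rewrite /dist; lia.
Qed.

(** The indicator of the ball is the difference of the cones of heights [r + 1] and [r]. *)
Lemma chips_pulse (f0 : face) (n r B : nat) : (r <= B)%N ->
  chips f0 B (pulse f0 n r) = n%:Z * (2 * r%:Z ^+ 2 + 2 * r%:Z + 1).
Proof.
move=> rB; rewrite /chips.
under eq_bigr => f _.
  rewrite pulseE (_ : (if _ then _ else _) =
    n%:Z * ((r.+1 - dist f0 f)%N%:Z - (r - dist f0 f)%N%:Z)); last by case: ifP; nia.
  over.
rewrite -mulr_sumr sumrB; congr (_ * _).
have h1 := @sum_box_cone f0 r.+1 B rB; have h2 := @sum_box_cone f0 r B (leqW rB).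
by apply: (@mulfI _ 3) => //; rewrite mulrBr h1 h2 -[r.+1]addn1 PoszD; ring.
Qed.

Lemma pulse_avoids_aztec (f0 : face) (n r : nat) : (1 <= n)%N ->
  (1 <= r)%N -> (n ^ 2 <= 3 * (r - 1) ^ 2)%N ->
  ~ can_terminate_in f0 (pulse f0 n r) (aztec f0 n).
Proof.
move=> n1 r1 nr [KA _]; have tK := pulse_tame f0 n r.
have nB : (n < (n + r).+1)%N by lia.
have := chips_fires nB KA tK; rewrite chips_pulse; last by lia.
have : (n <= (n + r).+1)%N by lia.
move=> /(chips_aztec f0) le1 le2.
(* With [m = r - 1], the claim is [6 n m^2 + 18 n m + 15 n > 2 n^3 + 6 n^2 + 7 n + 3], which follows
   from [n^2 <= 3 m^2], [n <= 2 m] and [n >= 1]. *)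
have nr' : (n < 2 * (r - 1) + 1)%N by nia.
have [m rE] : exists m, r = m.+1 by exists r.-1; lia.
subst r; rewrite subn1 /= in nr nr'.
nia.
Qed.

Lemma sqr_le_of_ceil (n r : nat) :
  Num.ceil (n%:R / sqrtC 3 : algC) + 1 <= r%:Z ->
  (1 <= r)%N /\ (n ^ 2 <= 3 * (r - 1) ^ 2)%N.
Proof.
have s0 : 0 < sqrtC 3 :> algC by rewrite sqrtC_gt0.
have x0 : 0 <= n%:R / sqrtC 3 :> algC by rewrite divr_ge0 // ltW.
have ceil0 := le_trans x0 (real_ceil_ge (ger0_real x0)).
rewrite ler0z in ceil0; move=> le_r.
have r1 : (1 <= r)%N by lia.
split=> //.
have : n%:R / sqrtC 3 <= (r - 1)%N%:R :> algC.
  apply: le_trans (real_ceil_ge (ger0_real x0)) _.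
  by rewrite -[leRHS]mulrz_nat ler_int; lia.
rewrite ler_pdivrMr // => le.
have : n%:R ^+ 2 <= ((r - 1)%N%:R * sqrtC 3) ^+ 2 :> algC.
  by apply: lerXn2r le; rewrite nnegrE ?mulr_ge0 // ltW.
rewrite exprMn sqrtCK -!natrX -natrM ler_nat; lia.
Qed.

(* uphalf n is the ceiling of n / 2. *)
Theorem theorem1p1 (f0 : face) (r n : nat) :
  [/\ (r <= 1)%N ->
        terminates_uniquely_in f0 (pulse f0 n r) (aztec f0 n),
      (2 <= r <= uphalf n)%N ->
        ~ terminates_uniquely f0 (pulse f0 n r) /\
        can_terminate_in f0 (pulse f0 n r) (aztec f0 n)
    & (uphalf n < r)%N ->
        ((2 <= n)%N -> ~ terminates_uniquely f0 (pulse f0 n r)) /\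
        ((1 <= n)%N -> Num.ceil (n%:R / sqrtC 3 : algC) + 1 <= r%:Z ->
         ~ can_terminate_in f0 (pulse f0 n r) (aztec f0 n))].
Proof.
split=> [r1|/andP[r2 rn]|nr].
- exact: pulse_small_radius.
- have az := pulse_reaches_aztec f0 rn; split=> //.
  by apply: pulse_exceeds_aztec => //; lia.
- split=> [n2|n1 /sqr_le_of_ceil[r1 rn]]; first exact: pulse_not_unique.
  exact: pulse_avoids_aztec.
Qed.
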